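(* Let $N_w, T$ be positive integers, $\mathcal{N}_w=\{1,\ldots,N_w\}$, $\mathcal{T}=\{1,\ldots,T\}$, and $\beta\in(0,1)$. For each $t\in\mathcal{T}$ let $\mathbf{b}^t=[b_1^t,\ldots,b_{N_w}^t]'\in\mathbb{R}^{N_w}$ (purchase prices) and $\mathbf{s}^t=[s_1^t,\ldots,s_{N_w}^t]'\in\mathbb{R}^{N_w}$ (selling prices) be given deterministic vectors, and set $\boldsymbol{\varpi}^t:=\frac{\mathbf{b}^t-\mathbf{s}^t}{2}$ and $\boldsymbol{\vartheta}^t:=\frac{\mathbf{b}^t+\mathbf{s}^t}{2}$. Let $\mathbf{w}=(\mathbf{w}^t)_{t\in\mathcal{T}}$ be a random vector with $\mathbf{w}^t\in\mathbb{R}^{N_w}$ for each $t$. For $\mathbf{p}_W=(\mathbf{p}_W^t)_{t\in\mathcal{T}}$ with $\mathbf{p}_W^t\in\mathbb{R}^{N_w}$, and $\eta\in\mathbb{R}$, define $$F_\beta(\mathbf{p}_W,\eta)=\eta+\frac{1}{1-\beta}\,\mathbb{E}_{\mathbf{w}}\left[\sum_{t=1}^T\Big(\boldsymbol{\varpi}^t\cdot|\mathbf{p}_W^t-\mathbf{w}^t|+\boldsymbol{\vartheta}^t\cdot(\mathbf{p}_W^t-\mathbf{w}^t)\Big)-\eta\right]^{+}.$$ If $s_m^t\le b_m^t$ for all $m\in\mathcal{N}_w$ and $t\in\mathcal{T}$, then $F_\beta(\mathbf{p}_W,\eta)$ is jointly convex with respect to $(\mathbf{p}_W,\eta)$.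
   Context: Notation: $[a]^+:=\max\{a,0\}$ for $a\in\mathbb{R}$; $\mathbf{a}\cdot\mathbf{b}$ is the Euclidean inner product; $|\cdot|$ applied to a vector is the entrywise absolute value; $\mathbb{E}_{\mathbf{w}}[X]^+$ means the expectation $\mathbb{E}_{\mathbf{w}}\big[\max\{X,0\}\big]$ over the distribution of $\mathbf{w}$. This is the expectation of a nonnegative random variable, so it is always defined in $[0,+\infty]$, and convexity of $F_\beta$ is understood for functions with values in $(-\infty,+\infty]$ (which is the usual notion when $F_\beta$ is finite). Interpretation: $\mathbf{p}_W^t$ is the wind power committed by the $N_w$ wind farms at time $t$ and $\mathbf{w}^t$ is the random actual wind power output. The sum $T(\mathbf{p}_W,\mathbf{w})=\sum_{t=1}^T\big(\mathbf{b}^t\cdot[\mathbf{p}_W^t-\mathbf{w}^t]^+-\mathbf{s}^t\cdot[\mathbf{w}^t-\mathbf{p}_W^t]^+\big)=\sum_{t=1}^T\big(\boldsymbol{\varpi}^t\cdot|\mathbf{p}_W^t-\mathbf{w}^t|+\boldsymbol{\vartheta}^t\cdot(\mathbf{p}_W^t-\mathbf{w}^t)\big)$ (with $[\cdot]^+$ entrywise on vectors) is the net transaction cost, and $F_\beta$ is the associated conditional value-at-risk objective at probability level $\beta$. *)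

(* Defs.v *)
From HB Require Import structures.
From mathcomp Require Import all_boot all_order all_algebra.
From mathcomp Require Import all_classical all_reals all_analysis.
From mathcomp Require Import interval_inference.

Set Implicit Arguments.
Unset Strict Implicit.
Unset Printing Implicit Defensive.

Import Order.TTheory GRing.Theory Num.Theory.
Import numFieldNormedType.Exports.

Local Open Scope classical_set_scope.
Local Open Scope ring_scope.
Local Open Scope convex_scope.

(* Counterpart of [convex_function] for functions with values in ]-oo, +oo].
   At t = 0 and t = 1 the convention 0 * +oo = 0 of [\bar R] makes the
   inequality trivial, so only 0 < t < 1 matters. *)
Definition convex_efunction (R : realType) (E : lmodType R)
    (E' := convex_lmodType E) (f : E' -> \bar R) :=
  (forall x, f x != -oo%E) /\
  forall (t : {i01 R}) (x y : E'),
    (f (x <| t |> y) <= (t%:num)%:E * f x + (1 - t%:num)%:E * f y)%E.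

Lemma convex_efunction_EFin (R : realType) (E : lmodType R)
    (f : convex_lmodType E -> R^o) :
  convex_efunction (EFin \o f) <-> convex_function [set: convex_lmodType E] f.
Proof.
split=> [[_ cf] t x y _ _|cf]; first by have := cf t x y; rewrite /= lee_fin.
by split=> [//|t x y]; rewrite /= lee_fin; apply: cf; rewrite inE.
Qed.

Definition dotv (R : realType) (n : nat) (u v : 'cV[R]_n) : R :=
  \sum_(m < n) u m 0 * v m 0.

Definition absv (R : realType) (n : nat) (u : 'cV[R]_n) : 'cV[R]_n :=
  map_mx (fun x => `|x|) u.

Section cvar.
Context (R : realType) (N T : nat).
Implicit Types (b s p v : 'I_T -> 'cV[R]_N).

Definition varpi b s (t : 'I_T) : 'cV[R]_N := 2^-1 *: (b t - s t).

Definition vartheta b s (t : 'I_T) : 'cV[R]_N := 2^-1 *: (b t + s t).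

Definition transaction_cost b s p v : R :=
  \sum_(t < T) (dotv (varpi b s t) (absv (p t - v t)) +
                dotv (vartheta b s t) (p t - v t)).

Context (d : measure_display) (Omega : measurableType d)
  (P : probability Omega R).

(* A random vector is given by its real-valued random coordinates;
   [realization w omega] is its value at the outcome [omega]. *)
Definition realization (w : 'I_T -> 'I_N -> {RV P >-> R}) (omega : Omega)
  : 'I_T -> 'cV[R]_N := fun t => \col_m w t m omega.

Definition F_beta (beta : R) b s (w : 'I_T -> 'I_N -> {RV P >-> R}) p (eta : R)
    : \bar R :=
  (eta%:E + ((1 - beta)^-1)%:E *
    'E_P[fun omega =>
      Num.max (transaction_cost b s p (realization w omega) - eta)%R 0%R])%E.

End cvar.

(* Main.v *)
(* At each outcome the transaction cost is convex in the committed power, since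
   |.| is convex and its coefficients (b - s) / 2 are nonnegative; subtracting
   the affine term eta and taking the positive part preserve joint convexity.
   The resulting inequality between nonnegative measurable functions is then
   integrated, which is valid in [0, +oo] without integrability. *)
Require Import Defs.
From mathcomp Require Import all_boot all_order all_algebra.
From mathcomp Require Import all_classical all_reals all_analysis.
From mathcomp Require Import interval_inference measurable_realfun ring lra.

Set Implicit Arguments.
Unset Strict Implicit.
Unset Printing Implicit Defensive.

Import Order.TTheory GRing.Theory Num.Theory.

Local Open Scope ring_scope.

Lemma ler_norm_conv (R : realDomainType) (a x y : R) : 0 <= a <= 1 ->
  `|a * x + (1 - a) * y| <= a * `|x| + (1 - a) * `|y|.
Proof.
move=> /andP[a0 a1]; rewrite (le_trans (ler_normD _ _))// !normrM.
by rewrite (ger0_norm a0) (@ger0_norm _ (1 - a)) ?subr_ge0.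
Qed.

(** The right-hand side bounds both arguments of the maximum: it is nonnegative, and it dominates
    the combination of [x] and [y] termwise. *)
Lemma ler_max0_conv (R : realDomainType) (a x y : R) : 0 <= a <= 1 ->
  Num.max (a * x + (1 - a) * y) 0 <=
  a * Num.max x 0 + (1 - a) * Num.max y 0.
Proof.
move=> /andP[a0 a1]; have a1' : 0 <= 1 - a by rewrite subr_ge0.
rewrite ge_max addr_ge0 ?mulr_ge0 ?le_max ?lexx ?orbT// andbT.
by rewrite lerD// ler_wpM2l// le_max lexx.
Qed.

(** Argued for each [t] and [m] separately: the [vartheta] term is affine in the commitment and
    contributes an equality, so only the absolute value term matters. *)
Lemma transaction_cost_conv (R : realType) (N T : nat)
    (b s p q v : 'I_T -> 'cV[R]_N) (a : R) : 0 <= a <= 1 ->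
  (forall m t, s t m 0 <= b t m 0) ->
  transaction_cost b s (fun t => a *: p t + (1 - a) *: q t) v <=
  a * transaction_cost b s p v + (1 - a) * transaction_cost b s q v.
Proof.
move=> a01 hsb; rewrite /transaction_cost !mulr_sumr -big_split /=.
apply: ler_sum => t _; rewrite /dotv -!big_split/= !mulr_sumr -big_split/=.
apply: ler_sum => m _; rewrite !mxE.
(* The price condition enters here: it makes the [varpi] weight nonnegative, so the bound on
   absolute values may be scaled by it. *)
have w0 : 0 <= 2^-1 * (b t m 0 - s t m 0).
  by rewrite mulr_ge0 ?invr_ge0 ?subr_ge0.
have := ler_wpM2l w0 (ler_norm_conv (p t m 0 - v t m 0) (q t m 0 - v t m 0) a01).
(* The weights sum to 1, so the same realization [v] can be subtracted before or after mixing. *)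
have -> : a * (p t m 0 - v t m 0) + (1 - a) * (q t m 0 - v t m 0) =
  a * p t m 0 + (1 - a) * q t m 0 - v t m 0 by ring.
lra.
Qed.

Section shortfall.
Context (R : realType) (N T : nat) (b s : 'I_T -> 'cV[R]_N).
Context (d : measure_display) (Omega : measurableType d)
  (P : probability Omega R) (w : 'I_T -> 'I_N -> {RV P >-> R}).

Lemma measurable_transaction_cost (p : 'I_T -> 'cV[R]_N) :
  measurable_fun setT (fun omega => transaction_cost b s p (realization w omega)).
Proof.
apply: measurable_sum => t.
have mpw m : measurable_fun setT
    (fun omega => (p t - realization w omega t) m 0).
  under eq_fun do rewrite !mxE.
  by apply: measurable_funB => //; exact: measurable_funPT.
apply: measurable_funD; apply: measurable_sum => m.
  under eq_fun do rewrite [absv _ _ _]mxE.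
  apply: measurable_funM => //.
  exact: measurableT_comp.
exact: measurable_funM.
Qed.

(** Convertible to the integrand of [F_beta], so the final proof can introduce it by a mere
    [change]. *)
Definition excess_cost (p : 'I_T -> 'cV[R]_N) (eta : R) (omega : Omega) : R :=
  Num.max (transaction_cost b s p (realization w omega) - eta) 0.

Lemma excess_cost_ge0 p eta omega : 0 <= excess_cost p eta omega.
Proof. by rewrite le_max lexx orbT. Qed.

Lemma measurable_excess_cost p eta : measurable_fun setT (excess_cost p eta).
Proof.
apply: measurable_maxr => //; apply: measurable_funB => //.
exact: measurable_transaction_cost.
Qed.

Context (hsb : forall m t, s t m 0 <= b t m 0).

Lemma excess_cost_conv (a : R) p q (eta xi : R) omega : 0 <= a <= 1 ->
  excess_cost (fun t => a *: p t + (1 - a) *: q t) (a * eta + (1 - a) * xi)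
    omega <=
  a * excess_cost p eta omega + (1 - a) * excess_cost q xi omega.
Proof.
move=> a01; apply: le_trans (ler_max0_conv _ _ a01).
(* By monotonicity of the positive part, it remains to compare the arguments; the [eta] and [xi]
   terms agree on both sides. *)
rewrite ge_max !le_max lexx orbT andbT.
have := transaction_cost_conv p q (realization w omega) a01 hsb.
by move=> h; apply/orP; left; lra.
Qed.

Lemma expectation_excess_cost_ge0 p eta : (0 <= 'E_P[excess_cost p eta])%E.
Proof. by apply: expectation_ge0 => omega; exact: excess_cost_ge0. Qed.

Lemma expectation_excess_cost_conv (a : R) p q (eta xi : R) : 0 <= a <= 1 ->
  ('E_P[excess_cost (fun t => (a *: p t + (1 - a) *: q t)%R)
                   (a * eta + (1 - a) * xi)%R] <=
   a%:E * 'E_P[excess_cost p eta] + (1 - a)%:E * 'E_P[excess_cost q xi])%E.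
Proof.
move=> a01; have /andP[a0 a1] := a01.
have mE p' eta' : measurable_fun setT (fun o => (excess_cost p' eta' o)%:E).
  by apply/measurable_EFinP; exact: measurable_excess_cost.
have mZ k p' eta' :
    measurable_fun setT (fun o => k%:E * (excess_cost p' eta' o)%:E)%E.
  exact: emeasurable_funM.
have E0 p' eta' o : (0 <= (excess_cost p' eta' o)%:E)%E.
  by rewrite lee_fin excess_cost_ge0.
have a1' : 0 <= 1 - a by rewrite subr_ge0.
have Z0 k p' eta' o : 0 <= k -> (0 <= k%:E * (excess_cost p' eta' o)%:E)%E.
  by move=> k0; rewrite mule_ge0.
(* The right-hand side is gathered into one integral, leaving a pointwise comparison. *)
rewrite unlock -!ge0_integralZl_EFin// -ge0_integralD//;
  try by move=> o _; exact: Z0.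
apply: ge0_le_integral => //.
- exact: emeasurable_funD.
- by move=> o _; rewrite lee_fin excess_cost_conv.
Qed.

End shortfall.

Theorem proposition1 (R : realType) (N T : nat) (hN : (0 < N)%N)
    (hT : (0 < T)%N) (beta : R) (hbeta : 0 < beta < 1)
    (b s : 'I_T -> 'cV[R]_N)
    (d : measure_display) (Omega : measurableType d) (P : probability Omega R)
    (w : 'I_T -> 'I_N -> {RV P >-> R})
    (hsb : forall (m : 'I_N) (t : 'I_T), s t m 0 <= b t m 0) :
  convex_efunction
    (fun x : ('I_T -> 'cV[R]_N) * R^o => F_beta beta b s w x.1 x.2).
Proof.
have c0 : 0 <= (1 - beta)^-1.
  by case/andP: hbeta => _ /ltW; rewrite invr_ge0 subr_ge0.
have cE0 p eta : (0 <= ((1 - beta)^-1)%:E * 'E_P[excess_cost b s w p eta])%E.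
  by rewrite mule_ge0 ?lee_fin// expectation_excess_cost_ge0.
split=> [[p eta]|t [p eta] [q xi]].
  (* The finite number [eta] is a lower bound of the objective. *)
  rewrite gt_eqF// (lt_le_trans (ltNyr eta))//= /F_beta leeDl//; exact: cE0.
have a01 : 0 <= t%:num <= 1 by rewrite ge0 le1.
set a : R := t%:num in a01 *; have /andP[a0 a1] := a01.
have a1' : 0 <= 1 - a by rewrite subr_ge0.
change ((a * eta + (1 - a) * xi)%:E + ((1 - beta)^-1)%:E *
    'E_P[excess_cost b s w (fun i => a *: p i + (1 - a) *: q i)%R
                           (a * eta + (1 - a) * xi)%R] <=
  a%:E * (eta%:E + ((1 - beta)^-1)%:E * 'E_P[excess_cost b s w p eta]) +
  (1 - a)%:E * (xi%:E + ((1 - beta)^-1)%:E * 'E_P[excess_cost b s w q xi]))%E.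
(* Distributing over a possibly infinite expectation is sound because the other summand is finite;
   the affine parts then cancel. *)
rewrite !muleDr ?fin_num_adde_defr// addeACA -!EFinM -EFinD leeD2l//.
(* Factoring out [(1 - beta)^-1] relies on both weighted expectations being nonnegative. *)
rewrite (muleCA a%:E) (muleCA (1 - a)%:E) -ge0_muleDr; first last.
- by rewrite mule_ge0 ?lee_fin// expectation_excess_cost_ge0.
- by rewrite mule_ge0 ?lee_fin// expectation_excess_cost_ge0.
by rewrite lee_wpmul2l ?lee_fin// expectation_excess_cost_conv.
Qed.
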